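(* Let $T>0$, $\eta\in(0,1]$ and $p\geqslant1$ with $\frac1p+\eta>1$. Let $A\in\mathcal{C}^{p\text{-var}}_{[0,T]}(\mathcal{C}^\eta)$ with $A_{s,t}(y)\geqslant0$ for all $y\in\mathbb{R}$ and all $0\leqslant s\leqslant t\leqslant T$. Then for any $x_0\in\mathbb{R}$ there exists a solution $x\in\mathcal{C}^{1\text{-var}}_{[0,T]}$ to the nonlinear Young equation $$x_t=x_0+\int_0^tA_{dr}(x_r),\qquad\forall t\in[0,T].$$
   Context: $\mathcal{C}^\eta$ is the Banach space of bounded $\eta$-Hölder continuous functions $f:\mathbb{R}\to\mathbb{R}$ with norm $\|f\|_\infty+\sup_{x\ne y}|f(x)-f(y)|/|x-y|^\eta$. For a Banach space $F$, $\mathcal{C}^{p\text{-var}}_{[0,T]}(F)$ is the set of continuous functions $[0,T]\to F$ with finite $p$-variation; $\mathcal{C}^{1\text{-var}}_{[0,T]}$ is the case $F=\mathbb{R}$, $p=1$. $A_{s,t}:=A_t-A_s$. Nonlinear Young integral: for $A\in\mathcal{C}^{p\text{-var}}_{[0,T]}(\mathcal{C}^\eta)$ and $x\in\mathcal{C}^{q\text{-var}}_{[0,T]}$ with $\frac1p+\frac\eta q>1$, $\int_s^tA_{dr}(x_r)$ is the limit of $\sum_iA_{t_i,t_{i+1}}(x_{t_i})$ along partitions of $[s,t]$ with mesh tending to $0$ (the limit exists and does not depend on the partitions). Here $q=1$. *)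

(* Defs.v *)
From HB Require Import structures.
From mathcomp Require Import all_boot all_order all_algebra.
From mathcomp Require Import all_classical all_reals all_analysis.

Set Implicit Arguments.
Unset Strict Implicit.
Unset Printing Implicit Defensive.

Import Order.TTheory GRing.Theory Num.Theory.
Import numFieldNormedType.Exports.

Local Open Scope classical_set_scope.
Local Open Scope ring_scope.

Section holder_space.
Context {R : realType} (eta : R).
Implicit Types f g : R -> R.

Definition sup_values f : set R := [set `|f x| | x in [set: R]].

Definition holder_quotients f : set R :=
  [set `|f z.1 - f z.2| / `|z.1 - z.2| `^ eta
    | z in [set z : R * R | z.1 != z.2]].

Definition bounded_holder : {pred R -> R} := mem [set f |
  has_ubound (sup_values f) /\ has_ubound (holder_quotients f)].

Definition holder_norm f : R := sup (sup_values f) + sup (holder_quotients f).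

Record holder := Holder {
  holder_fun :> R -> R ;
  _ : holder_fun \in bounded_holder }.

HB.instance Definition _ := [isSub for holder_fun].
HB.instance Definition _ := [Choice of holder by <:].

Lemma bounded_holder_submod_closed : submod_closed bounded_holder.
Proof.
split.
  apply/mem_set; split; exists 0 => _ /= [z _ <-]; first by rewrite normr0.
  by rewrite subrr normr0 mul0r.
move=> a f g /set_mem[[Mf Mfu] [Hf Hfu]] /set_mem[[Mg Mgu] [Hg Hgu]].
apply/mem_set; split.
  exists (`|a| * Mf + Mg) => _ /= [x _ <-].
  rewrite (le_trans (ler_normD _ _))// lerD//; last by apply: Mgu; exists x.
  by rewrite normrM ler_wpM2l//; apply: Mfu; exists x.
exists (`|a| * Hf + Hg) => _ /= [z zz <-].
have -> : (a *: f + g) z.1 - (a *: f + g) z.2 =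
    a * (f z.1 - f z.2) + (g z.1 - g z.2).
  by rewrite mulrBr -addrACA -opprD.
apply: (@le_trans _ _ (`|a| * (`|f z.1 - f z.2| / `|z.1 - z.2| `^ eta) +
    `|g z.1 - g z.2| / `|z.1 - z.2| `^ eta)).
  rewrite mulrA -mulrDl ler_wpM2r ?invr_ge0 ?powR_ge0//.
  by rewrite (le_trans (ler_normD _ _))// normrM.
by rewrite lerD ?ler_wpM2l//; [apply: Hfu|apply: Hgu]; exists z.
Qed.

HB.instance Definition _ := GRing.isSubmodClosed.Build _ _ bounded_holder
  bounded_holder_submod_closed.

HB.instance Definition _ := [SubChoice_isSubLmodule of holder by <:].

Implicit Types u v : holder.

Lemma has_ubound_sup_values u : has_ubound (sup_values u).
Proof. by case: u => f /= /set_mem[]. Qed.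

Lemma has_ubound_holder_quotients u : has_ubound (holder_quotients u).
Proof. by case: u => f /= /set_mem[]. Qed.

Lemma sup_values_neq0 f : sup_values f !=set0.
Proof. by exists `|f 0|; exists 0. Qed.

Lemma holder_quotients_neq0 f : holder_quotients f !=set0.
Proof. by eexists; exists (1, 0) => //=; exact: oner_neq0. Qed.

Lemma le_sup_values u x : `|u x| <= sup (sup_values u).
Proof. by apply: ub_le_sup; [exact: has_ubound_sup_values|exists x]. Qed.

Lemma le_sup_holder_quotients u x y : x != y ->
  `|u x - u y| / `|x - y| `^ eta <= sup (holder_quotients u).
Proof.
move=> xy; apply: ub_le_sup; first exact: has_ubound_holder_quotients.
by exists (x, y).
Qed.

Lemma sup_values_ge0 u : 0 <= sup (sup_values u).
Proof. exact: le_trans (normr_ge0 _) (le_sup_values u 0). Qed.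

Lemma sup_holder_quotients_ge0 u : 0 <= sup (holder_quotients u).
Proof.
apply: le_trans (le_sup_holder_quotients u (oner_neq0 _)).
by rewrite divr_ge0// powR_ge0.
Qed.

Lemma holder_normD u v :
  holder_norm (holder_fun (u + v)) <= holder_norm u + holder_norm v.
Proof.
rewrite /holder_norm addrACA lerD//.
  apply: ge_sup => [|_ [x _ <-]]; first exact: sup_values_neq0.
  by rewrite (le_trans (ler_normD _ _))// lerD// le_sup_values.
apply: ge_sup => [|_ [z zz <-]]; first exact: holder_quotients_neq0.
rewrite (le_trans _ (lerD (le_sup_holder_quotients u zz)
  (le_sup_holder_quotients v zz)))//.
rewrite -mulrDl ler_wpM2r ?invr_ge0 ?powR_ge0//.
by rewrite (le_trans _ (ler_normD _ _))// addrACA -opprD.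
Qed.

Lemma holder_normZ_le a u : holder_norm (holder_fun (a *: u)) <= `|a| * holder_norm u.
Proof.
rewrite /holder_norm mulrDr lerD//.
  apply: ge_sup => [|_ [x _ <-]]; first exact: sup_values_neq0.
  by rewrite normrM ler_wpM2l// le_sup_values.
apply: ge_sup => [|_ [z zz <-]]; first exact: holder_quotients_neq0.
rewrite -(mulrBr a (u z.1) (u z.2)) normrM -mulrA ler_wpM2l//.
exact: le_sup_holder_quotients.
Qed.

Lemma holder_normZ a u : holder_norm (holder_fun (a *: u)) = `|a| * holder_norm u.
Proof.
apply/eqP; rewrite eq_le holder_normZ_le andTb.
have [->|a0] := eqVneq a 0.
  rewrite normr0 mul0r; apply: addr_ge0; first exact: sup_values_ge0.
  exact: sup_holder_quotients_ge0.
have /(ler_wpM2l (normr_ge0 a)) := holder_normZ_le a^-1 (a *: u).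
by rewrite scalerA mulVf// scale1r normfV mulrA mulfV ?normr_eq0// mul1r.
Qed.

Lemma holder_norm0_eq0 u : holder_norm u = 0 -> u = 0.
Proof.
move=> u0; apply/val_inj/funext => x /=; apply/eqP; rewrite -normr_le0 -u0.
by rewrite (le_trans (le_sup_values u x))// lerDl sup_holder_quotients_ge0.
Qed.

HB.instance Definition _ := @Lmodule_isNormed.Build R holder
  (fun u => holder_norm u) holder_normD holder_normZ holder_norm0_eq0.

Lemma holder_normE u : `|u| = holder_norm u. Proof. by []. Qed.

End holder_space.
Arguments holder {R} eta.

(* As in [itv_partition], the partition t_0 = a < t_1 < .. < t_m = b of [a, b]
   is represented by [:: t_1; ..; t_m], so that t_n is [nth b (a :: s) n]. *)

Section p_variation.
Context {R : realType} {V : normedModType R}.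

Definition pvariation (p a b : R) (f : R -> V) (s : seq R) : R :=
  let F := f \o nth b (a :: s) in
  \sum_(0 <= n < size s) `|F n.+1 - F n| `^ p.

(* The exponent 1/p of the p-variation seminorm is immaterial for finiteness. *)
Definition finite_pvariation (p a b : R) (f : R -> V) : Prop :=
  has_ubound [set pvariation p a b f s | s in itv_partition a b].

(* Only the values of [f] on [0, T] matter. *)
Definition continuous_pvar (p T : R) : set (R -> V) := [set f |
  {within `[0, T], continuous f} /\ finite_pvariation p 0 T f].

End p_variation.

Lemma finite_1variation {R : realType} (a b : R) (f : R -> R) :
  finite_pvariation 1 a b f <-> bounded_variation a b f.
Proof.
rewrite /finite_pvariation /bounded_variation /variations.
suff -> : pvariation 1 a b f = variation a b f by [].
apply/funext => s; rewrite /pvariation /variation.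
by apply: eq_bigr => i _; rewrite powRr1.
Qed.

Section nonlinear_young_integral.
Context {R : realType}.

Definition mesh (a b : R) (s : seq R) : R :=
  let t := nth b (a :: s) in
  \big[Num.max/0]_(0 <= n < size s) (t n.+1 - t n).

Definition mesh_to0 (a b : R) : set_system (seq R) :=
  filter_from [set d : R | 0 < d]
    (fun d => [set s | itv_partition a b s /\ mesh a b s < d]).

Global Instance mesh_to0_filter a b : Filter (mesh_to0 a b).
Proof.
apply: filter_from_filter; first by exists 1; exact: ltr01.
move=> d e d0 e0; exists (Num.min d e); first by rewrite /= lt_min d0 e0.
by move=> s [abs]; rewrite lt_min => /andP[sd se].
Qed.

Lemma mesh_to0_proper a b : a <= b -> ProperFilter (mesh_to0 a b).
Proof.
move=> ab; apply: filter_from_proper => d d0.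
have [->|ne_ab] := eqVneq a b.
  by exists [::]; split => //; rewrite /mesh big_geq.
have {ne_ab}lt_ab : a < b by rewrite lt_neqAle ne_ab.
pose n := (Num.truncn ((b - a) / d)).+1.
pose t k : R := a + k%:R * ((b - a) / n%:R).
have n0 : 0 < n%:R :> R by rewrite ltr0n.
have h0 : 0 < (b - a) / n%:R by rewrite divr_gt0// subr_gt0.
have hd : (b - a) / n%:R < d.
  by rewrite ltr_pdivrMr// mulrC -ltr_pdivrMr// truncnS_gt.
have t0 : t 0 = a by rewrite /t mul0r addr0.
have tn : t n = b by rewrite /t mulrCA mulfV ?gt_eqF// mulr1 addrC subrK.
have tS k : t k.+1 - t k = (b - a) / n%:R.
  by rewrite /t -natr1 mulrDl mul1r addrA [_ + _ + _ - _]addrC addKr.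
pose s := [seq t k | k <- iota 1 n].
have as_ : a :: s = [seq t k | k <- iota 0 n.+1].
  by rewrite /s /= t0.
exists s; split.
  split; last first.
    by rewrite (last_nth b) as_ size_map size_iota (nth_map 0%N) ?size_iota//
      nth_iota// tn.
  rewrite -[path _ _ _]/(sorted <%O (a :: s)) as_ sorted_map.
  apply: sub_sorted (iota_ltn_sorted 0 n.+1) => i j ij /=.
  by rewrite ltrD2l ltr_pM2r// ltr_nat.
rewrite /mesh as_ size_map size_iota.
rewrite big_nat; apply: bigmax_lt => // i /andP[_ ni].
have nth_t k : (k < n.+1)%N -> nth b [seq t j | j <- iota 0 n.+1] k = t k.
  by move=> kn; rewrite (nth_map 0%N) ?size_iota// nth_iota.
by rewrite !nth_t ?tS// ltnS ltnW.
Qed.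

(* \sum_n A_{t_n, t_{n+1}} (x_{t_n}) *)
Definition young_sum {eta : R} (A : R -> holder eta) (x : R -> R) (a b : R)
    (s : seq R) : R :=
  let t := nth b (a :: s) in
  \sum_(0 <= n < size s) (A (t n.+1) - A (t n)) (x (t n)).

Definition young_integrable {eta : R} (A : R -> holder eta) (x : R -> R)
    (a b : R) : Prop :=
  cvg (young_sum A x a b @ mesh_to0 a b).

Definition young_integral {eta : R} (A : R -> holder eta) (x : R -> R)
    (a b : R) : R :=
  lim (young_sum A x a b @ mesh_to0 a b).

(* [lim] is a junk value when there is no limit, so the existence of the
   integrals is part of being a solution. *)
Definition young_solution {eta : R} (A : R -> holder eta) (T x0 : R)
    (x : R -> R) : Prop :=
  forall t, 0 <= t <= T ->
    young_integrable A x 0 t /\ x t = x0 + young_integral A x 0 t.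

End nonlinear_young_integral.

(* Main.v *)
(* For x nondecreasing, |A_{u,t}(x_u) - A_{u,t}(x_s)| is at most
   |A_{u,t}| (x_u - x_s)^eta.  Writing |A_{u,t}| as a small power of its (small)
   value times a power of the control V of the p-variation of A, this is at most
   rho (V_t - V_s + x_t - x_s)^theta with theta > 1, so sewing bounds
   x_t - x_s - A_{s,t}(x_s) by a multiple of the control, with a constant that
   tends to 0 with t - s.  Euler schemes are nondecreasing because A_{s,t} >= 0,
   hence they satisfy this estimate on their grids; on short intervals it
   also bounds their increments, uniformly in the grid.  An ultrafilter on the
   finite subsets of [0, T] containing all refinements gives a pointwise limit x
   satisfying the estimate for all s <= t; summing it over a partition
   telescopes, which makes the Riemann sums converge to x_t - x_0. *)
Require Import Defs.
From mathcomp Require Import all_boot all_order all_algebra.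
From mathcomp Require Import all_classical all_reals all_analysis.
From mathcomp Require Import ring lra zify.
Import Order.TTheory GRing.Theory Num.Theory.
Import numFieldNormedType.Exports.
Local Open Scope classical_set_scope.
Local Open Scope ring_scope.

(** * Discrete sewing lemma *)

Lemma ex_last_nat (P : pred nat) i j : (i <= j)%N -> P i ->
  exists k, [/\ (i <= k)%N, (k <= j)%N, P k & k = j \/ ~~ P k.+1].
Proof.
move=> ij Pi.
have exP : exists k, ((i <= k <= j)%N && P k) by exists i; rewrite leqnn ij.
have ubP k : ((i <= k <= j)%N && P k) -> (k <= j)%N by case/andP => /andP[].
case: (ex_maxnP exP ubP) => k /andP[/andP[ik kj] Pk] maxk.
exists k; split => //.
have [->|nkj] := eqVneq k j; [by left|right].
apply/negP => PSk; suff : (k.+1 <= k)%N by rewrite ltnn.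
by apply: maxk; rewrite PSk andbT (leqW ik) ltn_neqAle nkj.
Qed.

Lemma powR2_subr_lt1 {R : realType} (theta : R) :
  1 < theta -> 2 `^ (1 - theta) < 1.
Proof.
move=> theta1; rewrite -(opprB theta 1) powRN invf_lt1 ?powR_gt0//.
have : 1 `^ (theta - 1) < 2 `^ (theta - 1) :> R.
  by apply: gt0_ltr_powR; rewrite ?subr_gt0 ?nnegrE ?ltr1n.
by rewrite powR1.
Qed.

Section discrete_sewing.
Context {R : realType} (theta K : R) (g : nat -> R) (e : nat -> nat -> R).
Variables m n : nat.
Hypothesis theta1 : 1 < theta.
Hypothesis K0 : 0 <= K.
Hypothesis ndg : {homo g : i j / (i <= j)%N >-> i <= j}.
Hypothesis e0 : forall i, e i i <= 0.
Hypothesis e1 : forall i, e i i.+1 <= 0.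
Hypothesis e3 : forall i k j, (m <= i)%N -> (i <= k)%N -> (k <= j)%N ->
  (j <= n)%N -> e i j <= e i k + e k j + K * (g j - g i) `^ theta.

(* Cutting [i, j] at the first index where [g] passes the middle of
   [g i, g j] leaves two pieces whose control is at most half the original. *)
Lemma discrete_sewing : (m <= n)%N ->
  e m n <= 2 / (1 - 2 `^ (1 - theta)) * K * (g n - g m) `^ theta.
Proof.
set C := 2 / _ * K; move=> mn.
have q1 := powR2_subr_lt1 theta theta1.
have C0 : 0 <= C by rewrite mulr_ge0// divr_ge0// subr_ge0 ltW.
(* [C] is the constant that the induction reproduces: the two halves contribute the factor 2^(1 -
   theta), and two uses of [e3] cost 2 K. *)
have CE : C = C * 2 `^ (1 - theta) + 2 * K.
  by rewrite /C; field; lra.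
clearbody C.
have th0 : 0 <= theta by rewrite (le_trans ler01)// ltW.
suff sew d i j : (j - i <= d)%N -> (m <= i)%N -> (i <= j)%N -> (j <= n)%N ->
    e i j <= C * (g j - g i) `^ theta by exact: (sew (n - m)%N).
elim: d i j => [|d IH] i j ijd mi ij jn.
  have -> : j = i by lia.
  by rewrite (le_trans (e0 _))// mulr_ge0// powR_ge0.
have [->|neq_ij] := eqVneq i j.
  by rewrite (le_trans (e0 _))// mulr_ge0// powR_ge0.
have lt_ij : (i < j)%N by rewrite ltn_neqAle neq_ij.
have dg0 : 0 <= g j - g i by rewrite subr_ge0 ndg.
pose P k := (k < j)%N && (g k - g i <= (g j - g i) / 2).
have Pi : P i by rewrite /P lt_ij subrr divr_ge0.
have [k [ik kj /andP[kltj gk] kstop]] := ex_last_nat _ _ _ ij Pi.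
have kid : (k - i <= d)%N by clear -ijd kltj; lia.
have kjd : (j - k.+1 <= d)%N by clear -ijd ik; lia.
have kn := leq_trans kj jn.
have mk : (m <= k.+1)%N := leq_trans mi (leqW ik).
have gk1 : g j - g k.+1 <= (g j - g i) / 2.
  case: kstop => [kj'|]; first by rewrite kj' ltnn in kltj.
  rewrite negb_and -leqNgt -ltNge => /orP[jk|]; last by lra.
  have -> : k.+1 = j by lia.
  by rewrite subrr divr_ge0.
have half a : 0 <= a -> a <= (g j - g i) / 2 ->
    C * a `^ theta <= C / 2 * 2 `^ (1 - theta) * (g j - g i) `^ theta.
  move=> a0 ah; rewrite -!mulrA ler_wpM2l//.
  have -> : 2^-1 * (2 `^ (1 - theta) * (g j - g i) `^ theta) =
      ((g j - g i) / 2) `^ theta :> R.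
    rewrite powRM ?invr_ge0// powRD ?pnatr_eq0 ?implybT// powRr1//.
    suff -> : 2^-1 `^ theta = 2 `^ (- theta) :> R by field.
    by rewrite -(powR_inv1 (ler0n R 2)) -powRrM mulN1r.
  by apply: ge0_ler_powR; rewrite ?nnegrE ?divr_ge0//.
have eik : e i k <= C / 2 * 2 `^ (1 - theta) * (g j - g i) `^ theta.
  apply: le_trans (IH i k kid mi ik kn) _.
  by apply: half => //; rewrite subr_ge0 ndg.
have ekj : e k.+1 j <= C / 2 * 2 `^ (1 - theta) * (g j - g i) `^ theta.
  apply: le_trans (IH k.+1 j kjd mk kltj jn) _.
  by apply: half => //; rewrite subr_ge0 ndg.
(* The single step from [k] to [k.+1] may carry most of the control, but [e] is nonpositive there by
   [e1], so isolating it costs only a second use of [e3]. *)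
have := e3 i k j mi ik kj jn.
have := e3 k k.+1 j (leq_trans mi ik) (leqnSn k) kltj jn.
have := e1 k.
have : K * (g j - g k) `^ theta <= K * (g j - g i) `^ theta.
  by rewrite ler_wpM2l// ge0_ler_powR ?nnegrE ?subr_ge0 ?ndg// lerD2l lerN2 ndg.
rewrite [X in _ -> _ -> _ -> _ -> _ <= X * _]CE.
by lra.
Qed.

End discrete_sewing.

(** * Pointwise bounds and continuity of Hölder functions *)

Section holder_bounds.
Context {R : realType} (eta : R).
Implicit Types f g : holder eta.

Lemma holderBE f g x : (f - g) x = f x - g x. Proof. by []. Qed.

Lemma holder_le_norm f x : `|f x| <= `|f|.
Proof.
rewrite holder_normE (le_trans (le_sup_values f x))// lerDl.
exact: sup_holder_quotients_ge0.
Qed.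

Lemma holder_dist_le f x y : 0 < eta -> `|f x - f y| <= `|f| * `|x - y| `^ eta.
Proof.
move=> eta0; have [->|xy] := eqVneq x y.
  by rewrite !subrr normr0 mulr_ge0// powR_ge0.
rewrite -ler_pdivrMr ?powR_gt0 ?normr_gt0 ?subr_eq0//.
rewrite (le_trans (le_sup_holder_quotients f xy))// holder_normE lerDr.
exact: sup_values_ge0.
Qed.

Lemma holder_continuous f : 0 < eta -> continuous f.
Proof.
move=> eta0 x; apply/cvgrPdist_le => /= eps eps0.
have N0 : 0 < 1 + `|f| by rewrite ltr_pwDl.
near=> y.
rewrite (le_trans (holder_dist_le _ _ _ eta0))//.
apply: (@le_trans _ _ ((1 + `|f|) * `|x - y| `^ eta)).
  by rewrite ler_wpM2r ?powR_ge0// lerDr.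
rewrite mulrC -ler_pdivlMr//.
(* Exhibits the radius (eps / (1 + |f|))^(1/eta) within which [y] has to lie. *)
have -> : eps / (1 + `|f|) = ((eps / (1 + `|f|)) `^ eta^-1) `^ eta.
  by rewrite -powRrM mulVf ?gt_eqF// powRr1// divr_ge0// ltW.
apply: ge0_ler_powR; rewrite ?nnegrE ?powR_ge0//; first exact: ltW.
near: y; apply: cvgr_dist_le; first exact: cvg_id.
by rewrite powR_gt0// divr_gt0.
Unshelve. all: by end_near. Qed.

End holder_bounds.

(** * Local estimates for one nondecreasing Euler scheme *)

Section monotone_euler_scheme.
Context {R : realType} (eta p alpha W : R).
Hypotheses (eta0 : 0 < eta) (eta1 : eta <= 1).
Hypotheses (alpha0 : 0 < alpha) (alphap : alpha * p < 1).
Hypothesis theta1 : 1 < alpha + eta.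
Let theta := alpha + eta.

(** The sewing constant, times the small factor rho^(1 - alpha p) of the defect, times the price (1
    + W)^(theta - 1) of replacing the power theta of the control by the control itself. *)
Definition sewing_modulus (rho : R) : R :=
  2 / (1 - 2 `^ (1 - theta)) * rho `^ (1 - alpha * p) * (1 + W) `^ (theta - 1).

Variables (B : nat -> holder eta) (v u : nat -> R) (m n : nat) (rho : R).
Hypothesis W0 : 0 <= W.
Hypothesis mn : (m <= n)%N.
Hypothesis ndv : {homo v : i j / (i <= j)%N >-> i <= j}.
Hypothesis vW : v n - v m <= W.
Hypothesis Bv : forall i j, (i <= j)%N -> `|B j - B i| `^ p <= v j - v i.
Hypothesis ndu : {homo u : i j / (i <= j)%N >-> i <= j}.
Hypothesis uE : forall k, u k.+1 = u k + (B k.+1 - B k) (u k).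
Hypothesis Brho : forall i j, (m <= i)%N -> (i <= j)%N -> (j <= n)%N ->
  `|B j - B i| <= rho.

(** The Hölder bound is N |u_k - u_i|^eta with N = |B_j - B_k|. Writing N = N^(1 - alpha p)
    (N^p)^alpha bounds it by a power of [rho] times an increment of [v] to the power alpha; the
    exponents alpha and eta add up to theta, and rescaling [u] by X costs X^eta <= X. *)
Lemma euler_sewing_defect X i k j : 1 <= X -> (m <= i)%N -> (i <= k)%N ->
  (k <= j)%N -> (j <= n)%N ->
  `|(B j - B k) (u k) - (B j - B k) (u i)| <=
  rho `^ (1 - alpha * p) * X * (v j - v i + (u j - u i) / X) `^ theta.
Proof.
move=> X1 mi ik kj jn.
have X0 : 0 < X by exact: (lt_le_trans ltr01 X1).
have le_v : v i <= v k by exact: ndv.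
have le_v' : v k <= v j by exact: ndv.
have le_u : u i <= u k by exact: ndu.
have le_u' : u k <= u j by exact: ndu.
have rho0 : 0 <= rho by rewrite (le_trans _ (Brho k j _ kj jn))// (leq_trans mi).
set D := v j - v i + _.
have duX : (u k - u i) / X <= (u j - u i) / X.
  by rewrite ler_pM2r ?invr_gt0// lerD2r.
have duX0 : 0 <= (u k - u i) / X by rewrite divr_ge0 ?subr_ge0// ltW.
have D0 : 0 <= D.
  by rewrite addr_ge0 ?subr_ge0 ?(le_trans le_v)// (le_trans duX0).
set N := `|B j - B k|.
have N0 : 0 <= N by exact: normr_ge0.
(* At N = 0 the identity relies on 1 - alpha p being nonzero, since 0 to the power 0 is 1. *)
have NE : N = N `^ (1 - alpha * p) * (N `^ p) `^ alpha.
  have [->|NN0] := eqVneq N 0.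
    by rewrite powR0 ?mul0r// gt_eqF// subr_gt0.
  by rewrite -powRrM -powRD ?NN0 ?implybT// (mulrC p) subrK powRr1.
apply: le_trans (holder_dist_le _ _ _ _ eta0) _; rewrite -/N NE.
have -> : `|u k - u i| = X * ((u k - u i) / X).
  by rewrite ger0_norm ?subr_ge0// mulrC divfK ?gt_eqF.
rewrite powRM//; last exact: ltW.
rewrite [D `^ _]powRD ?(gt_eqF (lt_trans ltr01 theta1))//.
rewrite [leLHS]mulrACA -[leLHS]mulrA -[leRHS]mulrA.
rewrite ler_pM ?mulr_ge0 ?powR_ge0//.
  by rewrite ge0_ler_powR ?nnegrE ?subr_ge0 ?(ltW alphap)// Brho// (leq_trans mi).
rewrite ler_pM ?mulr_ge0 ?powR_ge0//.
  rewrite -[leRHS](powRr1 (ltW X0)); exact: ler_powR.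
rewrite ler_pM ?powR_ge0//.
  rewrite ge0_ler_powR ?nnegrE ?powR_ge0 ?(ltW alpha0)// (le_trans (Bv _ _ kj))//.
  by rewrite /D; have := le_trans duX0 duX; lra.
rewrite ge0_ler_powR ?nnegrE ?(ltW eta0)//.
by rewrite /D; have := duX; lra.
Qed.

(* The increments of [u] are measured in units of X = 1 + (u n - u m): since
   X^eta <= X, the estimate is affine in [u n - u m]. *)
Lemma euler_local_estimate :
  `|u n - u m - (B n - B m) (u m)| <=
  sewing_modulus rho * ((1 + (u n - u m)) * (v n - v m) + (u n - u m)).
Proof.
have du0 : 0 <= u n - u m by rewrite subr_ge0 ndu.
have dv0 : 0 <= v n - v m by rewrite subr_ge0 ndv.
set X := 1 + (u n - u m).
have X1 : 1 <= X by rewrite lerDl.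
have X0 : 0 < X by exact: (lt_le_trans ltr01 X1).
have theta0 : theta != 0 by rewrite gt_eqF// (lt_trans ltr01 theta1).
set K := rho `^ (1 - alpha * p) * X.
have K0 : 0 <= K by rewrite mulr_ge0 ?powR_ge0// ltW.
pose g k := v k + u k / X.
pose e i j := `|u j - u i - (B j - B i) (u i)|.
have gE i j : g j - g i = v j - v i + (u j - u i) / X.
  by rewrite /g mulrBl; ring.
have ndg : {homo g : i j / (i <= j)%N >-> i <= j}.
  by move=> i j ij; rewrite lerD ?ndv// ler_pM2r ?invr_gt0// ndu.
have e0 i : e i i <= 0 by rewrite /e holderBE !subrr normr0.
have e1 i : e i i.+1 <= 0.
  by rewrite /e uE [u i + _]addrC addrK subrr normr0.
have e3 i k j : (m <= i)%N -> (i <= k)%N -> (k <= j)%N -> (j <= n)%N ->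
    e i j <= e i k + e k j + K * (g j - g i) `^ theta.
  move=> mi ik kj jn.
  have := euler_sewing_defect X i k j X1 mi ik kj jn; rewrite -gE => defect.
  rewrite (le_trans _ (lerD (lexx _) defect))// -addrA.
  rewrite (le_trans _ (lerD (lexx _) (ler_normD _ _)))//.
  rewrite (le_trans _ (ler_normD _ _))// le_eqVlt; apply/orP; left.
  by apply/eqP; congr `|_|; rewrite !holderBE; ring.
have := discrete_sewing theta K g e m n theta1 K0 ndg e0 e1 e3 mn.
set G := g n - g m.
have G0 : 0 <= G by rewrite subr_ge0 ndg.
(* In units of X the increment of [u] is at most 1, so [G] is bounded independently of the scheme
   and G^theta is at most a fixed multiple of [G]. *)
have GW : G <= 1 + W.
  rewrite /G gE addrC lerD// ler_pdivrMr// mul1r /X lerDr; exact: ler01.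
move=> /le_trans; apply.
have -> : G `^ theta = G `^ (theta - 1) * G.
  have [->|G_neq0] := eqVneq G 0; first by rewrite powR0// mulr0.
  by rewrite -[X in _ = _ * X]powRr1// -powRD ?G_neq0 ?implybT// subrK.
have -> : X * (v n - v m) + (u n - u m) = X * G.
  by rewrite /G gE [RHS]mulrDr [X * (_ / X)]mulrC divfK ?gt_eqF.
rewrite /sewing_modulus /K.
have C0 : 0 <= 2 / (1 - 2 `^ (1 - theta)) :> R.
  by rewrite divr_ge0// subr_ge0 ltW// powR2_subr_lt1.
have le_G : G `^ (theta - 1) <= (1 + W) `^ (theta - 1).
  have t1 : 0 <= theta - 1 by rewrite subr_ge0 ltW.
  by apply: (ge0_ler_powR t1) GW; rewrite nnegrE// addr_ge0.
set c := 2 / _ in C0 *; set r := rho `^ _.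
have r0 : 0 <= r by exact: powR_ge0.
set a := G `^ _ in le_G *; set b := (1 + W) `^ _ in le_G *.
have -> : c * (r * X) * (a * G) = c * r * X * G * a by ring.
have -> : c * r * b * (X * G) = c * r * X * G * b by ring.
rewrite ler_wpM2l//; apply: mulr_ge0 => //.
by apply: mulr_ge0; [exact: mulr_ge0|exact: ltW].
Qed.

(** Absorption: the error in the local estimate is at most half of 1 + (u_n - u_m), which is moved
    to the left-hand side. *)
Lemma euler_small_increment : sewing_modulus rho * (1 + W) <= 2^-1 ->
  u n - u m <= 2 * rho + 1.
Proof.
move=> small.
have du0 : 0 <= u n - u m by rewrite subr_ge0 ndu.
have dv0 : 0 <= v n - v m by rewrite subr_ge0 ndv.
have Bu : (B n - B m) (u m) <= rho.
  rewrite (le_trans (ler_norm _))// (le_trans (holder_le_norm _ _ _))//.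
  exact: Brho.
have := le_trans (ler_norm _) euler_local_estimate.
have S0 : 0 <= sewing_modulus rho.
  rewrite mulr_ge0 ?powR_ge0// mulr_ge0 ?powR_ge0// divr_ge0// subr_ge0.
  by rewrite ltW// powR2_subr_lt1.
set kappa := sewing_modulus rho in S0 small *.
have : kappa * ((1 + (u n - u m)) * (v n - v m) + (u n - u m)) <=
    (1 + (u n - u m)) * (kappa * (1 + W)).
  rewrite mulrCA ler_wpM2l//.
  have := ler_wpM2l (addr_ge0 ler01 du0) vW.
  by have := du0; lra.
have : (1 + (u n - u m)) * (kappa * (1 + W)) <= (1 + (u n - u m)) * 2^-1.
  by rewrite ler_wpM2l// addr_ge0.
by lra.
Qed.

End monotone_euler_scheme.

(** * Euler schemes along time grids, with bounds uniform in the grid *)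

Section euler_scheme.
Context {R : realType} {eta : R}.

Fixpoint euler_seq (B : nat -> holder eta) (x0 : R) (k : nat) : R :=
  if k is l.+1 then
    euler_seq B x0 l + (B l.+1 - B l) (euler_seq B x0 l)
  else x0.

Lemma nondecreasing_euler_seq (B : nat -> holder eta) (x0 : R) :
  (forall y k, 0 <= (B k.+1 - B k) y) ->
  {homo euler_seq B x0 : i j / (i <= j)%N >-> i <= j}.
Proof.
move=> B0; apply/nondecreasing_seqP => k /=; rewrite lerDl; exact: B0.
Qed.

End euler_scheme.

Section path.
Context {R : realType} (T eta p : R).
Hypotheses (T0 : 0 < T) (eta0 : 0 < eta) (eta1 : eta <= 1) (p1 : 1 <= p).
Hypothesis hpeta : 1 < p^-1 + eta.
Variables (A : R -> holder eta) (V : R -> R).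
Hypothesis A_ge0 : forall y s t : R, 0 <= s -> s <= t -> t <= T ->
  0 <= (A t - A s) y.
Hypothesis AV : forall s t : R, 0 <= s -> s <= t -> t <= T ->
  `|A t - A s| `^ p <= V t - V s.
Hypothesis A_unif : forall eps : R, 0 < eps -> exists2 h : R, 0 < h &
  forall s t : R, 0 <= s -> s <= t -> t <= T -> t - s <= h ->
  `|A t - A s| <= eps.

Let W := V T - V 0.
(* Strictly between 1 - eta and 1 / p. *)
Let alpha := (1 - eta + p^-1) / 2.

Let p0 : 0 < p. Proof. exact: (lt_le_trans ltr01 p1). Qed.

Let alpha0 : 0 < alpha.
Proof.
have := p0; rewrite -invr_gt0 /alpha; have := eta1; lra.
Qed.

Let alphap : alpha * p < 1.
Proof. by rewrite -ltr_pdivlMr// div1r /alpha; have := hpeta; lra. Qed.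

Let theta1 : 1 < alpha + eta.
Proof. by rewrite /alpha; have := hpeta; lra. Qed.

Lemma control_nondecreasing s t : 0 <= s -> s <= t -> t <= T -> V s <= V t.
Proof.
move=> s0 st tT; rewrite -subr_ge0; apply: le_trans (AV s t s0 st tT).
exact: powR_ge0.
Qed.

Let W0 : 0 <= W.
Proof. by rewrite subr_ge0 control_nondecreasing// ltW. Qed.

(** Follows from a <= 1 + a^p. It covers grid steps of any length, where uniform continuity gives
    nothing. *)
Lemma increment_le_control s t : 0 <= s -> s <= t -> t <= T ->
  `|A t - A s| <= 1 + W.
Proof.
move=> s0 st tT.
have VW : V t - V s <= W.
  apply: lerB; apply: control_nondecreasing => //; first exact: le_trans st.
  exact: le_trans tT.
apply: (@le_trans _ _ (1 + (V t - V s))); last by rewrite lerD2l.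
apply: le_trans (lerD (lexx _) (AV s t s0 st tT)).
have [N1|N1] := leP `|A t - A s| 1.
  by rewrite (le_trans N1)// lerDl powR_ge0.
rewrite -[leLHS]powRr1// (le_trans (ler_powR (ltW N1) p1))// lerDr.
exact: ler01.
Qed.

Lemma sewing_modulus_small kappa : 0 < kappa ->
  exists h rho, [/\ 0 < h, 0 <= rho <= 1,
    sewing_modulus eta p alpha W rho <= kappa &
    forall s t, 0 <= s -> s <= t -> t <= T -> t - s <= h ->
      `|A t - A s| <= rho].
Proof.
move=> kappa0.
set C := 2 / (1 - 2 `^ (1 - (alpha + eta))) * (1 + W) `^ (alpha + eta - 1).
have C0 : 0 <= C.
  rewrite mulr_ge0 ?powR_ge0// divr_ge0// subr_ge0 ltW//.
  exact: powR2_subr_lt1.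
have beta0 : 0 < 1 - alpha * p by rewrite subr_gt0.
(* The power is chosen so that C rho^(1 - alpha p) <= kappa, with 1 + C in place of C to avoid a
   zero denominator; the cap 1 keeps the increment bound 2 rho + 1 below 3. *)
pose rho := Num.min 1 ((kappa / (1 + C)) `^ (1 - alpha * p)^-1).
have C10 : 0 < 1 + C by rewrite ltr_pwDl.
have rho0 : 0 < rho.
  rewrite /rho lt_min ltr01/= powR_gt0//; exact: divr_gt0.
have [h h0 hA] := A_unif _ rho0.
exists h, rho; split => //.
  by rewrite (ltW rho0)/= /rho ge_min lexx.
have rhob : rho `^ (1 - alpha * p) <= kappa / (1 + C).
  have -> : kappa / (1 + C) =
      ((kappa / (1 + C)) `^ (1 - alpha * p)^-1) `^ (1 - alpha * p).
    by rewrite -powRrM mulVf ?gt_eqF// powRr1// ltW// divr_gt0.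
  apply: (ge0_ler_powR (ltW beta0)); rewrite ?nnegrE ?powR_ge0 ?(ltW rho0)//.
  by rewrite /rho ge_min lexx orbT.
rewrite /sewing_modulus mulrAC -/C.
apply: (@le_trans _ _ ((1 + C) * (kappa / (1 + C)))).
  by rewrite ler_pM ?powR_ge0// lerDr.
by rewrite mulrC divfK// gt_eqF.
Qed.

(** Repetitions are allowed, so a sorted finite list padded with [T] is a grid. *)
Definition time_grid (t : nat -> R) : Prop :=
  {homo t : i j / (i <= j)%N >-> i <= j} /\ forall k, 0 <= t k <= T.

Section grid.
Variables (t : nat -> R) (x0 : R).
Hypothesis tP : time_grid t.
Let u := euler_seq (A \o t) x0.

Lemma nondecreasing_euler : {homo u : i j / (i <= j)%N >-> i <= j}.
Proof.
apply: nondecreasing_euler_seq => y k /=; case: tP => ndt t0T.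
by apply: A_ge0; [case/andP: (t0T k)|exact: ndt|case/andP: (t0T k.+1)].
Qed.

Let ndv : {homo (V \o t) : i j / (i <= j)%N >-> i <= j}.
Proof.
move=> i j ij; case: tP => ndt t0T /=.
apply: control_nondecreasing; [|exact: ndt|].
  by case/andP: (t0T i).
by case/andP: (t0T j).
Qed.

Let vW m n : V (t n) - V (t m) <= W.
Proof.
case: tP => _ t0T; case/andP: (t0T n) => n0 nT; case/andP: (t0T m) => m0 mT.
by rewrite lerB// control_nondecreasing.
Qed.

Let Bv i j : (i <= j)%N ->
  `|(A \o t) j - (A \o t) i| `^ p <= (V \o t) j - (V \o t) i.
Proof.
move=> ij; case: tP => ndt t0T.
by apply: AV; [case/andP: (t0T i)|exact: ndt|case/andP: (t0T j)].
Qed.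

Section small_interval.
Variables (h rho : R) (m n : nat).
Hypothesis hA : forall s t, 0 <= s -> s <= t -> t <= T -> t - s <= h ->
  `|A t - A s| <= rho.
Hypotheses (mn : (m <= n)%N) (tmn : t n - t m <= h).

Let Brho i j : (m <= i)%N -> (i <= j)%N -> (j <= n)%N ->
  `|(A \o t) j - (A \o t) i| <= rho.
Proof.
move=> mi ij jn; case: tP => ndt t0T; apply: hA; last 1 first.
- by apply: le_trans tmn; rewrite lerB// ndt.
- by case/andP: (t0T i).
- exact: ndt.
- by case/andP: (t0T j).
Qed.

Lemma grid_local_estimate :
  `|u n - u m - (A (t n) - A (t m)) (u m)| <=
  sewing_modulus eta p alpha W rho *
    ((1 + (u n - u m)) * (V (t n) - V (t m)) + (u n - u m)).
Proof.
exact: (euler_local_estimate eta p alpha W eta0 eta1 alpha0 alphap theta1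
  (A \o t) (V \o t) u m n rho W0 mn ndv (vW m n) Bv nondecreasing_euler
  (fun=> erefl) Brho).
Qed.

Lemma grid_small_increment :
  sewing_modulus eta p alpha W rho * (1 + W) <= 2^-1 ->
  u n - u m <= 2 * rho + 1.
Proof.
exact: (euler_small_increment eta p alpha W eta0 eta1 alpha0 alphap theta1
  (A \o t) (V \o t) u m n rho W0 mn ndv (vW m n) Bv nondecreasing_euler
  (fun=> erefl) Brho).
Qed.

End small_interval.

(** Each round goes to the last index within time [h] of the start, gaining at most 3, and then
    makes one grid step of arbitrary length, gaining at most 1 + W. Time has then advanced by more
    than [h], so [N] drops by one. *)
Lemma grid_increment_chain h N m n : (m <= n)%N ->
  (forall i j, (i <= j)%N -> t j - t i <= h -> u j - u i <= 3) ->
  0 < h -> t n - t m <= N%:R * h -> u n - u m <= N.+1%:R * (4 + W).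
Proof.
move=> mn small h0; elim: N m n mn => [|N IH] m n mn tmn.
  have := small m n mn; rewrite mul1r; have := W0.
  by have := tmn; rewrite mul0r => tmn0 ? /(_ (le_trans tmn0 (ltW h0))); lra.
have Pm : t m - t m <= h by rewrite subrr ltW.
have [k [mk kn tkm]] := ex_last_nat (fun k => t k - t m <= h) m n mn Pm.
have ukm := small m k mk tkm.
have N1 : N.+1%:R * (4 + W) = (4 + W) + N%:R * (4 + W) by rewrite -natr1; ring.
have N2 : N.+2%:R * (4 + W) = (4 + W) + N.+1%:R * (4 + W).
  by rewrite -[N.+2%:R]natr1; ring.
have N0 : 0 <= N.+1%:R * (4 + W) by rewrite mulr_ge0// addr_ge0.
have [<-|neq_kn] := eqVneq k n => [_|kstop].
  by rewrite N2; have := W0; lra.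
have lt_kn : (k < n)%N by rewrite ltn_neqAle neq_kn.
case: kstop => [/eqP|]; first by rewrite (negbTE neq_kn).
rewrite -ltNge => tk1.
have : u n - u k.+1 <= N.+1%:R * (4 + W).
  apply: IH => //; have := tmn; have := tk1; rewrite -natr1 => ? ?.
  by lra.
have : u k.+1 - u k <= 1 + W.
  case: tP => ndt t0T.
  have -> : u k.+1 - u k = (A (t k.+1) - A (t k)) (u k).
    by rewrite addrC; exact: addKr.
  rewrite (le_trans (ler_norm _))// (le_trans (holder_le_norm _ _ _))//.
  apply: increment_le_control.
  - by case/andP: (t0T k).
  - exact: ndt.
  - by case/andP: (t0T k.+1).
by rewrite N2; lra.
Qed.

End grid.

Lemma grid_increment_bounded : exists2 M, 0 <= M & forall t x0 m n,
  time_grid t -> (m <= n)%N ->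
  euler_seq (A \o t) x0 n - euler_seq (A \o t) x0 m <= M.
Proof.
have W10 : 0 < 1 + W by rewrite ltr_pwDl.
(* The threshold at which [grid_small_increment] applies. *)
have kappa0 : 0 < 2^-1 / (1 + W) by rewrite divr_gt0// invr_gt0.
have [h [rho [h0 /andP[rho0 rho1] small hA]]] := sewing_modulus_small _ kappa0.
pose N := (Num.truncn (T / h)).+1.
have TN : T <= N%:R * h by rewrite -ler_pdivrMr// ltW// truncnS_gt.
exists (N.+1%:R * (4 + W)); first by rewrite mulr_ge0// addr_ge0.
move=> t x0 m n tP mn; apply: (grid_increment_chain t x0 tP h) => //.
  move=> i j ij tij.
  have := grid_small_increment t x0 tP h rho i j hA ij tij.
  rewrite -ler_pdivlMr// => /(_ small) /le_trans; apply.
  by have := rho1; lra.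
apply: le_trans TN; case: tP => _ t0T.
by case/andP: (t0T n) => _ nT; case/andP: (t0T m) => m0 _; lra.
Qed.

(** Inserting the global bound [M] into the factor 1 + (u_n - u_m) turns the right-hand side into
    [kappa] times an increment of (1 + M) V + u, which is additive in time. *)
Lemma grid_uniform_estimate : exists2 M, 0 <= M &
  (forall t x0 k, time_grid t -> x0 <= euler_seq (A \o t) x0 k <= x0 + M) /\
  forall kappa, 0 < kappa -> exists2 h, 0 < h & forall t x0 m n,
    time_grid t -> (m <= n)%N -> t n - t m <= h ->
    let u := euler_seq (A \o t) x0 in
    `|u n - u m - (A (t n) - A (t m)) (u m)| <=
    kappa * ((1 + M) * (V (t n) - V (t m)) + (u n - u m)).
Proof.
have [M M0 uM] := grid_increment_bounded; exists M => //; split.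
  move=> t x0 k tP; rewrite (nondecreasing_euler t x0 tP 0 k)//=.
  by rewrite -lerBlDl (uM t x0 0 k).
move=> kappa kappa0.
have [h [rho [h0 _ small hA]]] := sewing_modulus_small _ kappa0.
exists h => // t x0 m n tP mn tmn /=.
apply: le_trans (grid_local_estimate t x0 tP h rho m n hA mn tmn) _.
set u := euler_seq _ _.
have uM' : u n - u m <= M by exact: uM.
have du0 : 0 <= u n - u m by rewrite subr_ge0 (nondecreasing_euler t x0 tP).
have dV0 : 0 <= V (t n) - V (t m).
  case: tP => ndt t0T; rewrite subr_ge0 control_nondecreasing//.
  - by case/andP: (t0T m).
  - exact: ndt.
  - by case/andP: (t0T n).
apply: ler_pM => //.
- rewrite mulr_ge0 ?powR_ge0// mulr_ge0 ?powR_ge0// divr_ge0// subr_ge0 ltW//.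
  exact: powR2_subr_lt1.
- by rewrite addr_ge0// mulr_ge0// addr_ge0.
- by rewrite lerD2r ler_wpM2r// lerD2l.
Qed.

End path.

(** * Continuity and uniform continuity on a segment *)

Section segment_modulus.
Context {R : realType} {V : normedModType R} (f : R -> V) (a b : R).

Lemma segment_unif_continuous : {within `[a, b], continuous f} ->
  forall eps : R, 0 < eps -> exists2 h : R, 0 < h &
  forall s t, a <= s <= b -> a <= t <= b -> `|s - t| <= h ->
  `|f s - f t| <= eps.
Proof.
move=> /subspace_continuousP cf eps eps0.
have /compact_near_coveringP/near_covering_withinP cov :=
  @segment_compact R a b.
pose P h s := forall t, a <= t <= b -> `|s - t| <= h -> `|f s - f t| <= eps.
have nearP : \forall h \near 0^'+, `[a, b] `<=` P h.
  apply: cov => x xab.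
  have /cvgrPdist_lt/(_ (eps / 2)) := cf x xab.
  rewrite divr_gt0// => /(_ isT); rewrite near_withinE.
  move=> /nbhs_ballP[d /= d0 fd].
  have d20 : 0 < d / 2 by rewrite divr_gt0.
  (* Half of [d] for the distance from [x] to [y] and half for the shift from [y] to [t] keep [t]
     within [d] of [x]. *)
  exists (ball x (d / 2), [set h | h < d / 2]) => /=.
    split; first exact: nbhsx_ballx.
    exact: nbhs_right_lt.
  move=> [y h] /= [xy hd] yab t tab yt.
  have fy : `|f x - f y| < eps / 2.
    apply: fd => //; apply: lt_le_trans xy _.
    by rewrite ler_pdivrMr// ler_pMr// ler1n.
  have ft : `|f x - f t| < eps / 2.
    apply: fd; last by rewrite /= in_itv.
    rewrite /ball/= -(subrKA y) (le_lt_trans (ler_normD _ _))//.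
    have := xy; rewrite /ball/= => ?; lra.
  rewrite -(subrKA (f x)) (le_trans (ler_normD _ _))// distrC; lra.
have [h [h0 hP]] : exists h, 0 < h /\ `[a, b] `<=` P h.
  have : \forall h \near 0^'+, 0 < h /\ `[a, b] `<=` P h.
    by near=> h; split; near: h => //; exact: nbhs_right_gt.
  by move=> /filter_ex.
exists h => // s t sab tab st.
by apply: hP => //=; rewrite in_itv.
Unshelve. all: by end_near. Qed.

Lemma segment_modulus_continuous :
  (forall eps : R, 0 < eps -> exists2 h : R, 0 < h &
    forall s t, a <= s -> s <= t -> t <= b -> t - s <= h ->
    `|f t - f s| <= eps) ->
  {within `[a, b], continuous f}.
Proof.
move=> fmod; apply/subspace_continuousP => x /=; rewrite in_itv/= => /andP[ax xb].
apply/cvgrPdist_le => /= eps eps0; have [h h0 hf] := fmod _ eps0.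
rewrite near_withinE; apply/nbhs_ballP; exists h => //= y.
rewrite /ball/= in_itv/= => xy /andP[ay yb].
have [le_xy|/ltW le_yx] := leP x y.
  rewrite distrC hf// (le_trans _ (ltW xy))// distrC; exact: ler_norm.
by rewrite hf// (le_trans _ (ltW xy))// ler_norm.
Qed.

End segment_modulus.

(** * An additive control of the p-variation *)

Section pvariation_control.
Context {R : realType} {V : normedModType R} (p T : R) (f : R -> V).

Lemma pvariation_rcons a b c s : itv_partition a b s ->
  pvariation p a c f (rcons s c) =
  pvariation p a b f s + `|f c - f b| `^ p.
Proof.
move=> abs; have sz := itv_partition_nth_size b abs.
rewrite /pvariation size_rcons big_nat_recr//=; congr (_ + _).
  apply: eq_big_nat => i /andP[_ isz].
  rewrite -rcons_cons !nth_rcons/= isz ltnS (ltnW isz).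
  by congr (`| f _ - f _ | `^ _); apply: set_nth_default => //=;
    rewrite ltnS ltnW.
rewrite nth_rcons ltnn eqxx -rcons_cons nth_rcons/= ltnSn.
by rewrite (set_nth_default b)//= sz.
Qed.

(* v t is the p-th power of the p-variation on [0, t]: its increments are
   additive, whereas (s, t) |-> the p-variation on [s, t] is superadditive. *)
Lemma finite_pvariation_control : p != 0 -> 0 <= T ->
  finite_pvariation p 0 T f -> exists v : R -> R, forall s t, 0 <= s -> s <= t -> t <= T ->
    `|f t - f s| `^ p <= v t - v s.
Proof.
move=> p0 T0 [M MT].
pose S t := [set pvariation p 0 t f l | l in itv_partition 0 t].
(* Any partition of [0, t] extends to [0, T] by the single point [T], so one bound serves all
   [t]. *)
have SM t : 0 <= t -> t <= T -> ubound (S t) M.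
  move=> t0; rewrite le_eqVlt => /predU1P[->//|tT] _ [l tl <-].
  apply: le_trans (_ : pvariation p 0 T f (rcons l T) <= M).
    by rewrite (pvariation_rcons 0 t)// lerDl powR_ge0.
  apply: MT; exists (rcons l T) => //; rewrite -cats1.
  exact: (itv_partition_cat tl (itv_partition1 tT)).
have S0 t : 0 <= t -> S t !=set0.
  rewrite le_eqVlt => /predU1P[<-|t0].
    by exists (pvariation p 0 0 f [::]); exists [::].
  by eexists; exists [:: t] => //; exact: itv_partition1.
exists (fun t => sup (S t)) => s t s0; rewrite le_eqVlt => /predU1P[->|st] tT.
  by rewrite !subrr normr0 powR0.
rewrite lerBrDr addrC -lerBrDr; apply: ge_sup; first exact: S0.
move=> _ [l sl <-]; rewrite lerBrDr -(pvariation_rcons 0 s)//.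
apply: ub_le_sup; first by exists M; apply: SM => //; exact/ltW/(le_lt_trans s0).
exists (rcons l t) => //; rewrite -cats1.
exact: (itv_partition_cat sl (itv_partition1 st)).
Qed.

End pvariation_control.

(** * Convergence of the Riemann sums *)

Section young_sums.
Context {R : realType} {eta : R} (T : R) (A : R -> holder eta) (x G : R -> R).
Hypothesis xG : forall kappa, 0 < kappa -> exists2 h, 0 < h &
  forall r t, 0 <= r -> r <= t -> t <= T -> t - r <= h ->
  `|x t - x r - (A t - A r) (x r)| <= kappa * (G t - G r).

Lemma young_sum_cvg t : 0 <= t <= T -> 0 <= G t - G 0 ->
  young_sum A x 0 t s @[s --> mesh_to0 0 t] --> x t - x 0.
Proof.
move=> /andP[t0 tT] G0; apply/cvgrPdist_le => /= eps eps0.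
have G10 : 0 < 1 + (G t - G 0) by rewrite ltr_pwDl.
(* The errors on the cells telescope to kappa (G t - G 0); the added 1 allows for G t = G 0. *)
have [h h0 hx] := xG _ (divr_gt0 eps0 G10).
exists h => //= s [st sh].
set y := nth t (0 :: s).
have y0 : y 0%N = 0 by [].
have yn : y (size s) = t by exact: itv_partition_nth_size.
rewrite -[in x t]yn -[in x 0]y0.
rewrite -(@telescope_sumr _ _ _ (x \o y) (leq0n (size s))) -sumrB.
apply: le_trans (ler_norm_sum _ _ _) _.
apply: (@le_trans _ _ (\sum_(0 <= k < size s)
    (eps / (1 + (G t - G 0)) * (G (y k.+1) - G (y k))))).
  rewrite !big_nat; apply: ler_sum => k /andP[_ ks] /=.
  apply: hx.
  - exact: (itv_partition_nth_ge (leqW ks) st).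
  - case: st => pth _; move/(pathP t)/(_ k ks)/ltW: pth; exact.
  - rewrite (le_trans _ tT)//.
    exact: (itv_partition_nth_le (ks : (k.+1 < (size s).+1)%N) st).
  - rewrite ltW// (le_lt_trans _ sh)// /mesh -/y.
    by rewrite (bigD1_seq k) ?mem_index_iota ?iota_uniq//= le_max lexx.
rewrite -mulr_sumr (telescope_sumr (G \o y))//= yn y0.
rewrite mulrAC ler_pdivrMr// ler_wpM2l ?(ltW eps0)// lerDr.
exact: ler01.
Qed.

End young_sums.

(** * Limits along ultrafilters and the refinement filter *)

Lemma ler_cvg {R : realType} {I : Type} {F : set_system I} {PF : ProperFilter F}
    (f g : I -> R) (l l' : R) :
  f i @[i --> F] --> l -> g i @[i --> F] --> l' ->
  (\forall i \near F, f i <= g i) -> l <= l'.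
Proof.
move=> fl gl' fg; rewrite -subr_ge0.
apply: (closed_cvg (fun y : R => 0 <= y)) (cvgB gl' fl); first exact: closed_ge.
by apply: filterS fg => i; rewrite subr_ge0.
Qed.

(** A set of a finer proper filter whose preimage is not in [F] has a complement whose preimage is,
    and then the finer filter contains both the set and its complement. *)
Lemma ultra_fmap {I J : Type} (f : I -> J) (F : set_system I) :
  UltraFilter F -> UltraFilter (f @ F).
Proof.
move=> UF; split; first exact: fmap_proper_filter.
move=> G PG FG; apply/seteqP; split => // B GB.
have [//|nB] := in_ultra_setVsetC (f @^-1` B) UF.
exfalso; apply: (@filter_not_empty _ G).
by rewrite -(setICr B); apply: filterI => //; exact: FG.
Qed.

Section refinement.
Context {T : eqType}.

(** The filter of finite sets directed by inclusion: each given point lies in eventually every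
    list. *)
Definition refinement : set_system (seq T) :=
  filter_from [set: seq T] (fun s => [set s' : seq T | {subset s <= s'}]).

Lemma refinement_proper : ProperFilter refinement.
Proof.
apply: filter_from_proper; last by move=> s _; exists s.
apply: filter_fromT_filter; first by exists [::].
move=> s1 s2; exists (s1 ++ s2) => s ss; split => r rs; apply: ss;
  by rewrite mem_cat rs ?orbT.
Qed.

End refinement.

(** * Grids built from finite sets of times *)

Section euler_points.
Context {R : realType} (T : R).
Hypothesis T0 : 0 <= T.

(** Adding 0 makes every scheme start at time 0. A duplicated time is harmless, as its Euler step
    vanishes. *)
Definition euler_points (s : seq R) : seq R :=
  sort <=%O (0 :: [seq r <- s | 0 <= r <= T]).

Lemma mem_euler_points s r :
  (r \in euler_points s) = (r == 0) || (0 <= r <= T) && (r \in s).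
Proof. by rewrite mem_sort inE mem_filter. Qed.

Lemma euler_points_itv s k : 0 <= nth T (euler_points s) k <= T.
Proof.
have [ks|ks] := ltnP k (size (euler_points s)); last first.
  by rewrite nth_default// T0 lexx.
have := mem_nth T ks; rewrite mem_euler_points.
by move=> /predU1P[->|/andP[//]]; rewrite lexx.
Qed.

Lemma euler_points_grid s : time_grid T (nth T (euler_points s)).
Proof.
split; last exact: euler_points_itv.
move=> i j ij; have [js|js] := ltnP j (size (euler_points s)); last first.
  by rewrite [leRHS]nth_default//; case/andP: (euler_points_itv s i).
apply: (sorted_leq_nth le_trans (@lexx _ _)) => //; first exact: sort_le_sorted.
exact: leq_ltn_trans ij js.
Qed.

Lemma index0_euler_points s : index 0 (euler_points s) = 0%N.
Proof.
have s0 : 0 \in euler_points s by rewrite mem_euler_points eqxx.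
have [ndt _] := euler_points_grid s.
have := ndt _ _ (leq0n (index 0 (euler_points s))).
rewrite nth_index// => le0.
have /andP[ge0 _] := euler_points_itv s 0.
have : nth T (euler_points s) 0 = 0 by apply/eqP; rewrite eq_le le0.
by case: euler_points s0 => //= r l _ ->; rewrite eqxx.
Qed.

Lemma index_euler_points_le s r t : r \in euler_points s ->
  t \in euler_points s -> r <= t ->
  (index r (euler_points s) <= index t (euler_points s))%N.
Proof.
move=> rs ts rt; rewrite leqNgt; apply/negP => lt_tr.
have [ndt _] := euler_points_grid s.
have := ndt _ _ (ltnW lt_tr); rewrite !nth_index// => le_tr.
have rtE : r = t by apply/eqP; rewrite eq_le rt.
by move: lt_tr; rewrite rtE ltnn.
Qed.

End euler_points.

(** * The pointwise limit of the Euler schemes *)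

Section existence.
Context {R : realType} (T eta p : R).
Hypotheses (T0 : 0 < T) (eta0 : 0 < eta) (eta1 : eta <= 1) (p1 : 1 <= p).
Hypothesis hpeta : 1 < p^-1 + eta.
Variables (A : R -> holder eta) (V : R -> R) (x0 : R).
Hypothesis A_ge0 : forall y s t : R, 0 <= s -> s <= t -> t <= T ->
  0 <= (A t - A s) y.
Hypothesis AV : forall s t : R, 0 <= s -> s <= t -> t <= T ->
  `|A t - A s| `^ p <= V t - V s.
Hypothesis A_unif : forall eps : R, 0 < eps -> exists2 h : R, 0 < h &
  forall s t : R, 0 <= s -> s <= t -> t <= T -> t - s <= h ->
  `|A t - A s| <= eps.

(** Meaningful at grid times only: elsewhere [index] returns the length of the list, which gives the
    value at the padding time [T]. *)
Definition euler (s : seq R) (r : R) : R :=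
  euler_seq (A \o nth T (euler_points T s)) x0 (index r (euler_points T s)).

Let T0' := ltW T0.

Lemma euler_limit : exists2 M, 0 <= M & exists x : R -> R,
  [/\ x 0 = x0,
    forall r t, 0 <= r -> r <= t -> t <= T -> x r <= x t &
    forall kappa, 0 < kappa -> exists2 h, 0 < h &
      forall r t, 0 <= r -> r <= t -> t <= T -> t - r <= h ->
      `|x t - x r - (A t - A r) (x r)| <=
      kappa * ((1 + M) * (V t - V r) + (x t - x r))].
Proof.
have [M M0 [uM uloc]] := grid_uniform_estimate T eta p T0 eta0 eta1 p1 hpeta
  A V A_ge0 AV A_unif.
exists M => //.
have [U [UU refU]] := ultraFilterLemma (@refinement_proper R).
have PU : ProperFilter U by exact: ultra_proper.
(* The image ultrafilter contains the compact segment [x0, x0 + M], hence converges. *)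
have cvgE r : cvg (euler s r @[s --> U]).
  have UE := ultra_fmap (euler^~ r) U UU.
  have := @segment_compact R x0 (x0 + M); rewrite compact_ultra.
  move=> /(_ _ UE)[|l [_ El]]; last by apply/cvg_ex; exists l.
  apply: (@filterE _ U) => s /=; rewrite in_itv/=.
  exact: uM (euler_points_grid T T0' s).
pose x r := lim (euler s r @[s --> U]).
have xE r : euler s r @[s --> U] --> x r by exact: cvgE.
have near_mem r : 0 <= r <= T -> \forall s \near U, r \in euler_points T s.
  move=> rT; apply: refU; exists [:: r] => // s /= /(_ r (mem_head _ _)) rs.
  by rewrite mem_euler_points rT rs orbT.
have near2 r t : 0 <= r -> r <= t -> t <= T -> \forall s \near U,
    r \in euler_points T s /\ t \in euler_points T s.
  move=> r0 rt tT.
  apply: filterI; apply: near_mem.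
    by rewrite r0 (le_trans rt).
  by rewrite (le_trans r0).
exists x; split.
- have E0 : euler s 0 @[s --> U] --> x0.
    suff -> : euler^~ 0 = cst x0 by exact: cvg_cst.
    by apply/funext => s; rewrite /euler index0_euler_points.
  exact: (cvg_lim _ E0).
- move=> r t r0 rt tT; apply: ler_cvg (xE r) (xE t) _.
  apply: filterS (near2 r t r0 rt tT) => s [rs ts].
  apply: (nondecreasing_euler T eta A A_ge0); first exact: euler_points_grid.
  exact: index_euler_points_le.
(* [h] is independent of the grid and [r], [t] are eventually grid times, so both sides pass to the
   limit; on the left this uses continuity of the Hölder function A_t - A_r. *)
- move=> kappa kappa0; have [h h0 hloc] := uloc _ kappa0.
  exists h => // r t r0 rt tT trh.
  apply: (@ler_cvg _ _ U _
    (fun s => `|euler s t - euler s r - (A t - A r) (euler s r)|)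
    (fun s => kappa * ((1 + M) * (V t - V r) + (euler s t - euler s r)))).
  + apply: cvg_norm; apply: cvgB; first by apply: cvgB; exact: xE.
    by apply: continuous_cvg; [exact: holder_continuous|exact: xE].
  + apply: cvgM; first exact: cvg_cst.
    apply: cvgD; first exact: cvg_cst.
    by apply: cvgB; exact: xE.
  + apply: filterS (near2 r t r0 rt tT) => s [rs ts].
    have := hloc _ x0 _ _ (euler_points_grid T T0' s)
      (index_euler_points_le T T0' s r t rs ts rt).
    by rewrite !nth_index// => /(_ trh).
Qed.

End existence.

(** * Regularity of the limit and the Young equation *)

Theorem theorem3p4 (R : realType) (T eta p : R) (hT : 0 < T)
  (heta0 : 0 < eta) (heta1 : eta <= 1) (hp : 1 <= p) (hpeta : 1 < p^-1 + eta)
  (A : R -> holder eta) (hA : continuous_pvar p T A)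
  (hA0 : forall y s t : R, 0 <= s -> s <= t -> t <= T -> 0 <= (A t - A s) y)
  (x0 : R) :
  exists x : R -> R, continuous_pvar 1 T x /\ young_solution A T x0 x.
Proof.
case: hA => Ac Av.
have p0 : p != 0 by rewrite gt_eqF// (lt_le_trans ltr01).
have [V AV] := finite_pvariation_control p T A p0 (ltW hT) Av.
have A_unif eps : 0 < eps -> exists2 h : R, 0 < h & forall s t, 0 <= s ->
    s <= t -> t <= T -> t - s <= h -> `|A t - A s| <= eps.
  move=> /(segment_unif_continuous A 0 T Ac)[h h0 hA]; exists h => //.
  move=> s t s0 st tT ts; apply: hA.
  - by rewrite (le_trans s0).
  - by rewrite s0 (le_trans st).
  - by rewrite ger0_norm// subr_ge0.
have [M M0 [x [x0E ndx xloc]]] := euler_limit T eta p hT heta0 heta1 hp hpeta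
  A V x0 hA0 AV A_unif.
have M10 : 0 <= 1 + M by rewrite addr_ge0.
have ndV s t : 0 <= s -> s <= t -> t <= T -> V s <= V t.
  exact: control_nondecreasing AV s t.
(* The local estimate bounds its error by [kappa] times an increment of [G]. *)
pose G t := (1 + M) * V t + x t.
have GE s t : G t - G s = (1 + M) * (V t - V s) + (x t - x s).
  by rewrite /G; ring.
have ndG s t : 0 <= s -> s <= t -> t <= T -> 0 <= G t - G s.
  move=> s0 st tT.
  by rewrite GE addr_ge0 ?mulr_ge0// subr_ge0 ?ndV ?ndx.
exists x; split; first split.
(* [V] is only known to be monotone, so continuity comes from [A]: half of [eps] bounds
   |A_{s,t}(x_s)|, the other half the local error, where [G] merely has to be bounded. *)
- apply: segment_modulus_continuous => eps eps0.
  have e2 : 0 < eps / 2 by rewrite divr_gt0.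
  have G1 : 0 < 1 + (G T - G 0) by rewrite ltr_pwDl// ndG// ltW.
  have [h1 h10 hx] := xloc _ (divr_gt0 e2 G1).
  have [h2 h20 hA] := A_unif _ e2.
  exists (Num.min h1 h2) => [|s t s0 st tT]; first by rewrite lt_min h10.
  rewrite le_min => /andP[th1 th2].
  have := hx s t s0 st tT th1; rewrite -GE => xA.
  have GG : G t - G s <= 1 + (G T - G 0).
    have := ndG 0 s (lexx 0) s0 (le_trans st tT).
    have := ndG t T (le_trans s0 st) tT (lexx T).
    lra.
  have xA2 : eps / 2 / (1 + (G T - G 0)) * (G t - G s) <= eps / 2.
    by rewrite -mulrA ger_pMr// mulrC ler_pdivrMr// mul1r.
  have Ax := le_trans (holder_le_norm _ _ (x s)) (hA s t s0 st tT th2).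
  have -> : x t - x s = (x t - x s - (A t - A s) (x s)) + (A t - A s) (x s).
    by ring.
  by rewrite (le_trans (ler_normD _ _))//; lra.
(* Finite 1-variation comes from monotonicity alone. *)
- apply/finite_1variation/nondecreasing_bounded_variation => r t.
  by rewrite !in_itv/= => /andP[r0 _] /andP[_ tT] rt; exact: ndx.
- move=> t tT.
  have xG kappa : 0 < kappa -> exists2 h, 0 < h & forall r t, 0 <= r ->
      r <= t -> t <= T -> t - r <= h ->
      `|x t - x r - (A t - A r) (x r)| <= kappa * (G t - G r).
    move=> /xloc[h h0 hx]; exists h => // r u r0 ru uT urh.
    by rewrite GE hx.
  have /andP[t0 le_tT] := tT.
  have cx := young_sum_cvg T A x G xG t tT (ndG 0 t (lexx 0) t0 le_tT).
  split; first by apply/cvg_ex; exists (x t - x 0).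
  have PF := mesh_to0_proper t0.
  by rewrite /young_integral (cvg_lim _ cx)// x0E addrC subrK.
Qed.
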